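(* Let $F$ be a field, let $m(x)=x^3+ax^2+bx+c\in F[x]$ be irreducible, and let $S\subseteq\mathcal{C}(m)$. (1) If there exist distinct $A,B,C\in S$ such that $B-A$ is singular, $C-A$ is singular, and $\mathfrak{n}(B-A)\neq\mathfrak{n}(C-A)$, then $S$ is core. (2) If $F=\mathbb{F}_q$, $|S|\geq q^3-q^2+1$, and there exists $A\in S$ such that $B-A$ is singular for all $B\in S$, then $S$ is core.
   Context: $M_3(F)$ is the ring of $3\times 3$ matrices over $F$. $\mathcal{C}(m)$ is the set of all $A\in M_3(F)$ whose minimal polynomial is $m$. For $X\in M_3(F)$, $\mathfrak{n}(X)=\{v\in F^3 : vX=0\}$ is the left nullspace of $X$, where $F^3$ denotes row vectors. For polynomials in $M_3(F)[x]$ the indeterminate $x$ is central, and $f(x)=\sum_i \alpha_i x^i$ is evaluated at $A\in M_3(F)$ by right evaluation, $f(A)=\sum_i \alpha_i A^i$. For $S\subseteq M_3(F)$, the null ideal is $N(S)=\{f\in M_3(F)[x] : f(A)=0 \text{ for all } A\in S\}$. The set $S$ is called core if $N(S)$ is a two-sided ideal of $M_3(F)[x]$. *)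

(* Defs.v *)
From mathcomp Require Import all_boot all_order all_algebra.
From mathcomp Require Import boolp classical_sets functions cardinality.

Set Implicit Arguments.
Unset Strict Implicit.
Unset Printing Implicit Defensive.

Import GRing.Theory.
Local Open Scope classical_set_scope.
Local Open Scope ring_scope.

(* The whole ring is allowed, unlike in ring_quotient where ideals are proper:
   the null ideal of the empty set is the whole ring. *)
Definition two_sided_ideal (R : pzRingType) (I : set R) : Prop :=
  [/\ I 0,
      forall f g, I f -> I g -> I (f - g),
      forall h f, I f -> I (h * f)
    & forall h f, I f -> I (f * h)].

Section NullIdeals.
Variable F : fieldType.

Definition minpoly_class (m : {poly F}) : set 'M[F]_3 :=
  [set A | mxminpoly A = m].

Definition left_nullspace (X : 'M[F]_3) : set 'rV[F]_3 :=
  [set v | v *m X = 0].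

(* In {poly R} the indeterminate is central, and f.[A] is \sum_i f`_i * A ^+ i
   (horner_coef), i.e. right evaluation. *)
Definition null_ideal (S : set 'M[F]_3) : set {poly 'M[F]_3} :=
  [set f | forall A, S A -> f.[A] = 0].

Definition core (S : set 'M[F]_3) : Prop := two_sided_ideal (null_ideal S).

Definition singular (X : 'M[F]_3) : Prop := X \notin unitmx.

End NullIdeals.

(* Main.v *)
(** Let [t] be a root of [m] in an extension [L] of [F]. Each [A] in [C(m)] has
    an eigenvector [x_A] over [L] for [t], no nonzero row over [F] kills [x_A],
    and for [f] in [M_3(F)[X]] we have [f(A) x_A = f(t) x_A]. If [f(A) = 0]
    forces [f(t) = 0] as [A] ranges over [S], then [S] is core because
    evaluation at the central element [t] is multiplicative. This happens as
    soon as three elements of [S] have linearly independent eigenvectors, which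
    is what different nullspaces provide. In part (2), if [S] were not core,
    all [B] in [S] would agree on one row [y]; such a [B] is determined by
    [y B^2], which lies outside the plane spanned by [y] and [y A], leaving at
    most [q^3 - q^2] possibilities. *)
Require Import Defs.
From mathcomp Require Import all_boot all_order all_algebra.
From mathcomp Require Import fieldext.
From mathcomp Require Import boolp classical_sets functions cardinality.

Set Implicit Arguments.
Unset Strict Implicit.
Unset Printing Implicit Defensive.

Import GRing.Theory.
Local Open Scope classical_set_scope.
Local Open Scope card_scope.
Local Open Scope ring_scope.

(** * Krylov bases for matrices with an irreducible cubic minimal polynomial *)

Section Krylov.
Variables (F : fieldType) (m : {poly F}).
Hypotheses (m_irr : irreducible_poly m) (m_size : size m = 4%N).
Implicit Types (A B : 'M[F]_3) (y z : 'rV[F]_3).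

Definition krylov (y : 'rV[F]_3) (A : 'M[F]_3) : 'M[F]_3 :=
  \matrix_(i < 3) (y *m A ^+ i).

Lemma coprimep_small (p : {poly F}) :
  p != 0 -> (size p < 4)%N -> coprimep m p.
Proof.
move=> p0 ps; rewrite irreducible_poly_coprime //.
by apply/negP => /(dvdp_leq p0); rewrite m_size leqNgt ps.
Qed.

(** A Bezout identity [u m + v p = 1] evaluated at [A] loses its first term, since [m(A) = 0], and
    leaves [v(A)] as an inverse of [p(A)]. *)
Lemma horner_mx_small_unit A (p : {poly F}) :
  mxminpoly A = m -> p != 0 -> (size p < 4)%N -> horner_mx A p \in unitmx.
Proof.
move=> Am p0 ps.
have /Bezout_eq1_coprimepP [[u v] /= uv1] := coprimep_small p0 ps.
have /mulmx1_unit [] // : horner_mx A v *m horner_mx A p = 1%:M.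
rewrite -[1%:M]/1 -(rmorph1 (horner_mx A)) -uv1 rmorphD !rmorphM /=.
by rewrite -Am mx_root_minpoly mulr0 add0r.
Qed.

Lemma mul_krylov (u : 'rV[F]_3) y A :
  u *m krylov y A = y *m horner_mx A (rVpoly u).
Proof.
rewrite mulmx_sum_row horner_rVpoly [u *m powers_mx _ _]mulmx_sum_row.
rewrite linear_sum mulmx_sumr.
apply: eq_bigr => i _.
by rewrite linearZ /= -scalemxAr !rowK mxvecK.
Qed.

Lemma mul_krylovE (u : 'rV[F]_3) y A :
  u *m krylov y A =
  u 0 0 *: y + u 0 1 *: (y *m A) + u 0 2%:R *: (y *m A *m A).
Proof.
rewrite mulmx_sum_row !big_ord_recl big_ord0 addr0 addrA.
rewrite !rowK /= expr0 expr1 mulmx1 expr2 mulmxA.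
by congr (_ *: _ + _ *: _ + _ *: _); congr (u _ _); apply: val_inj.
Qed.

Lemma krylov_mul_eq0 y A n (d : 'M[F]_(3, n)) :
  y *m d = 0 -> y *m A *m d = 0 -> y *m A *m A *m d = 0 -> krylov y A *m d = 0.
Proof.
move=> yd yAd yAAd; apply/row_matrixP => i; rewrite row_mul rowK linear0.
by case: i => [[|[|[|]]]] //= _; rewrite ?expr0 ?mulmx1 ?expr2 ?mulmxA.
Qed.

(** A relation among [y], [y A], [y A^2] reads [y p(A) = 0] with [p] of degree at most 2; if [p]
    were nonzero, [p(A)] would be invertible and [y] zero. *)
Lemma krylov_unit y A : mxminpoly A = m -> y != 0 -> krylov y A \in unitmx.
Proof.
move=> Am y0; rewrite -row_free_unit; apply: inj_row_free => u.
rewrite mul_krylov => /eqP yu0; apply/eqP; apply: contraT => u0.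
have pu0 : rVpoly u != 0.
  by apply: contra u0 => /eqP pu0; rewrite -[u]rVpolyK pu0 linear0.
have U := horner_mx_small_unit Am pu0 (size_poly _ _).
by move: y0; rewrite -(mulmxK U y) (eqP yu0) mul0mx eqxx.
Qed.

End Krylov.

(** * Eigenvectors over an extension field containing a root of [m] *)

Section Eigenvectors.
Variables (F L : fieldType) (iota : {rmorphism F -> L}) (m : {poly F}) (t : L).
Hypotheses (m_irr : irreducible_poly m) (m_size : size m = 4%N).
Hypothesis m_root : root (map_poly iota m) t.
Implicit Types (A B : 'M[F]_3) (y z : 'rV[F]_3) (x xA xB xC : 'cV[L]_3).
Local Notation "A ^i" := (map_mx iota A) (at level 2, format "A ^i").

Lemma linear_indep_root (a b : F) : iota a + iota b * t = 0 -> b = 0.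
Proof.
move=> ab0; apply/eqP; apply: contraT => b0.
pose p : {poly F} := b *: 'X + a%:P.
have ps : size p = 2
  by rewrite /p -mul_polyC size_MXaddC polyC_eq0 (negPf b0) size_polyC b0.
have p0 : p != 0 by rewrite -size_poly_eq0 ps.
have cp : coprimep (map_poly iota m) (map_poly iota p).
  by rewrite coprimep_map (coprimep_small m_irr) // ps.
have := coprimep_root cp m_root.
by rewrite /p rmorphD /= map_polyZ map_polyX map_polyC !hornerE addrC ab0 eqxx.
Qed.

Lemma eigenvector_exists A :
  mxminpoly A = m -> exists2 x : 'cV[L]_3, x != 0 & A^i *m x = t *: x.
Proof.
move=> Am; have : root (map_poly iota (char_poly A)) t.
  have /dvdpP [p ->] := mxminpoly_dvd_char A.
  by rewrite Am rmorphM rootM m_root orbT.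
rewrite map_char_poly -eigenvalue_root_char => /eigenvalueP [v vA v0].
(* [eigenvalueP] gives a row eigenvector; passing to the transpose through the determinant gives a
   column one. *)
have : \det (A^i - t%:M)^T = 0.
  rewrite det_tr; apply/eqP/det0P; exists v => //.
  by rewrite mulmxBr vA mul_mx_scalar subrr.
move=> /eqP/det0P [w w0 wA]; exists w^T; first by rewrite trmx_eq0.
apply/eqP; rewrite -subr_eq0 -mul_scalar_mx -mulmxBl -trmx_eq0 trmx_mul trmxK.
by rewrite wA.
Qed.

Lemma mul_eigenvector_exp A x (n : nat) :
  A^i *m x = t *: x -> (A ^+ n)^i *m x = t ^+ n *: x.
Proof.
move=> Ax; elim: n => [|n IH]; first by rewrite !expr0 map_mx1 mul1mx scale1r.
by rewrite exprSr map_mxM -mulmxA Ax -scalemxAr IH scalerA exprS.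
Qed.

Lemma map_krylov y A : (krylov y A)^i = krylov y^i A^i.
Proof.
by apply/row_matrixP => i; rewrite -map_row !rowK map_mxM rmorphXn.
Qed.

Lemma krylov_eigenvector A y x : A^i *m x = t *: x ->
  (krylov y A)^i *m x = \col_(i < 3) (t ^+ i * (y^i *m x) 0 0).
Proof.
move=> Ax; apply/row_matrixP => i.
rewrite row_mul -map_row rowK map_mxM -mulmxA mul_eigenvector_exp //.
by rewrite -scalemxAr; apply/matrixP => j k; rewrite !mxE !ord1.
Qed.

(** The Krylov matrix of [y] sends [x] to the column of the [t^i (y x)]. For nonzero [y] it is
    invertible, so [y x = 0] would force [x = 0]. *)
Lemma mul_eigenvector_eq0 A y x : mxminpoly A = m -> x != 0 ->
  A^i *m x = t *: x -> y^i *m x = 0 -> y = 0.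
Proof.
move=> Am x0 Ax yx0; apply/eqP; apply: contraT => y0.
have U : (krylov y A)^i \in unitmx by rewrite map_unitmx (krylov_unit m_irr).
have : (krylov y A)^i *m x = 0.
  by rewrite krylov_eigenvector // yx0; apply/colP => i; rewrite !mxE mulr0.
by move/(canRL (mulKmx U)); rewrite mulmx0 => /eqP; rewrite (negPf x0).
Qed.

Lemma mul_eigenvector_neq0 A y x : mxminpoly A = m -> x != 0 ->
  A^i *m x = t *: x -> y != 0 -> (y^i *m x) 0 0 != 0.
Proof.
move=> Am x0 Ax; apply: contra => /eqP yx0.
apply/eqP/(mul_eigenvector_eq0 Am x0 Ax).
by apply/rowP => i; rewrite !ord1 yx0 mxE.
Qed.

(** The rows of [A - B] are defined over [F] and kill [x], so they vanish. *)
Lemma eigenvector_inj A B x : mxminpoly A = m -> x != 0 ->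
  A^i *m x = t *: x -> B^i *m x = t *: x -> A = B.
Proof.
move=> Am x0 Ax Bx; apply/row_matrixP => i.
apply/eqP; rewrite -subr_eq0 -linearB.
apply/eqP/(mul_eigenvector_eq0 Am x0 Ax).
by rewrite map_row -row_mul map_mxB mulmxBl Ax Bx subrr linear0.
Qed.

(** Once [xB] is rescaled so that [y xB = y xA], the common Krylov matrix sends both eigenvectors to
    the same column. It is invertible, so they coincide and determine the same matrix. *)
Lemma krylov_inj A B y : mxminpoly A = m -> mxminpoly B = m -> y != 0 ->
  krylov y A = krylov y B -> A = B.
Proof.
move=> Am Bm y0 PAB.
have [xA xA0 AxA] := eigenvector_exists Am.
have [xB xB0 BxB] := eigenvector_exists Bm.
have yA0 := mul_eigenvector_neq0 Am xA0 AxA y0.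
have U : (krylov y A)^i \in unitmx by rewrite map_unitmx (krylov_unit m_irr).
have BxB' : B^i *m (((y^i *m xA) 0 0 / (y^i *m xB) 0 0) *: xB) =
   t *: (((y^i *m xA) 0 0 / (y^i *m xB) 0 0) *: xB).
  by rewrite -scalemxAr BxB !scalerA mulrC.
have yB0 := mul_eigenvector_neq0 Bm xB0 BxB y0.
apply: (eigenvector_inj Am xA0 AxA).
suff -> : xA = ((y^i *m xA) 0 0 / (y^i *m xB) 0 0) *: xB by [].
apply: (can_inj (mulKmx U)) => /=; rewrite krylov_eigenvector // PAB -scalemxAr.
rewrite krylov_eigenvector //.
move: {BxB' yA0} (_ 0 0) (_ 0 0) yB0 => p q q0; apply/colP => i; rewrite !mxE.
by rewrite mulrCA mulfVK.
Qed.

(* Scaled so that [y xA = y xB], the difference [xA - xB] is killed by [y] and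
   [y A], so it spans the line of columns orthogonal to them; a row killing
   both eigenvectors is then a combination of [y] and [y A]. *)
Lemma kill_eigenvector_pair A B y xA xB (s : 'rV[L]_3) :
  mxminpoly A = m -> mxminpoly B = m -> A <> B -> y != 0 ->
  y *m A = y *m B -> xA != 0 -> xB != 0 ->
  A^i *m xA = t *: xA -> B^i *m xB = t *: xB ->
  s *m xA = 0 -> s *m xB = 0 ->
  exists k, s = k *: (y^i *m A^i - t *: y^i).
Proof.
move=> Am Bm AB y0 yAB xA0 xB0 AxA BxB sA sB.
have yA0 := mul_eigenvector_neq0 Am xA0 AxA y0.
have yB0 := mul_eigenvector_neq0 Bm xB0 BxB y0.
have U : (krylov y A)^i \in unitmx by rewrite map_unitmx (krylov_unit m_irr).
(* Scaling each eigenvector by the pairing of [y] with the other one equalizes the two pairings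
   without division. *)
pose d := (y^i *m xB) 0 0 *: xA - (y^i *m xA) 0 0 *: xB.
have d0 : d != 0.
  apply/eqP => /eqP; rewrite subr_eq0 => /eqP dE; apply: AB.
  have x0 : (y^i *m xB) 0 0 *: xA != 0 by rewrite scaler_eq0 negb_or yB0.
  apply: (eigenvector_inj Am x0).
    by rewrite -scalemxAr AxA !scalerA mulrC.
  by rewrite dE -scalemxAr BxB !scalerA mulrC.
have yd : y^i *m d = 0.
  rewrite mulmxBr -!scalemxAr; apply/rowP => i.
  by rewrite !ord1 !mxE mulrC subrr.
have yAd : y^i *m A^i *m d = 0.
  rewrite mulmxBr -!scalemxAr -mulmxA AxA -map_mxM yAB map_mxM -mulmxA BxB.
  rewrite -!scalemxAr !(scalerA _ t) ![_ * t]mulrC -!(scalerA t) -scalerBr.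
  by rewrite !(scalemxAr _ y^i) -mulmxBr -/d yd scaler0.
pose u := s *m invmx (krylov y A)^i.
have sE : s =
    u 0 0 *: y^i + u 0 1 *: (y^i *m A^i) + u 0 2%:R *: (y^i *m A^i *m A^i).
  by rewrite -[LHS](mulmxKV U) -/u map_krylov mul_krylovE.
(* If [y A^2] killed [d] as [y] and [y A] do, the invertible Krylov matrix would kill it too. *)
have u2 : u 0 2%:R = 0.
  have : s *m d = 0 by rewrite mulmxBr -!scalemxAr sA sB !scaler0 subr0.
  rewrite sE !mulmxDl -!scalemxAl yd yAd !scaler0 !add0r => /eqP.
  rewrite scaler_eq0 => /orP[/eqP //|/eqP yAAd].
  case/negP: d0; rewrite -(mulKmx U d); apply/eqP.
  suff -> : (krylov y A)^i *m d = 0 by rewrite mulmx0.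
  by rewrite map_krylov krylov_mul_eq0.
(* Now [s xA = (u0 + t u1) (y xA)], so [u0 = - t u1]. *)
exists (u 0 1); move: sA; rewrite sE u2 scale0r addr0 mulmxDl -!scalemxAl.
rewrite -mulmxA AxA -scalemxAr scalerA -scalerDl => /eqP.
rewrite scaler_eq0 => /orP[|/eqP yx]; last by move: yA0; rewrite yx mxE eqxx.
rewrite addr_eq0 => /eqP ->.
by rewrite scalerBr scalerA scaleNr addrC.
Qed.

(* The column [d] orthogonal to [y] and [y A] is defined over [F], so if it
   kills [z A - t z] with [1], [t] independent over [F], it kills [z] and [z A];
   this puts [z] on the line of [y]. *)
Lemma pencil_scale_eq0 A y z (j k : L) : mxminpoly A = m -> y != 0 ->
  (forall a, z <> a *: y) ->
  j *: (y^i *m A^i - t *: y^i) = k *: (z^i *m A^i - t *: z^i) -> k = 0.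
Proof.
move=> Am y0 zy jk; apply/eqP; apply: contraT => k0.
have U : krylov y A \in unitmx by rewrite (krylov_unit m_irr).
(* The last vector of the dual basis: it pairs to 0 with [y] and [y A], and to 1 with [y A^2]. *)
pose d : 'cV[F]_3 := invmx (krylov y A) *m delta_mx 2%:R 0.
have rowd (i : 'I_3) : y *m A ^+ i *m d = (i == 2%:R)%:R%:M.
  rewrite -(rowK (fun i : 'I_3 => y *m A ^+ i)) -/(krylov y A) -row_mul.
  rewrite mulKVmx //.
  by apply/matrixP => r s; rewrite !ord1 !mxE eqxx andbT mulr1n.
have yd : y *m d = 0 by have := rowd 0; rewrite expr0 mulmx1 raddf0.
have yAd : y *m A *m d = 0 by have := rowd 1; rewrite expr1 raddf0.
have yAAd : y *m A *m A *m d = 1%:M.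
  have : y *m A ^+ 2 *m d = _ := rowd 2%:R.
  by rewrite expr2 eqxx [y *m (A * A)]mulmxA.
have : (k *: (z^i *m A^i - t *: z^i)) *m d^i = 0.
  rewrite -jk -scalemxAl mulmxBl -scalemxAl -!map_mxM yd yAd !map_mx0.
  by rewrite scaler0 subrr scaler0.
rewrite -scalemxAl => /eqP; rewrite scaler_eq0 (negPf k0) /= mulmxBl -scalemxAl.
rewrite -!map_mxM => /eqP/matrixP/(_ 0 0); rewrite !mxE => H.
have zd0 : (z *m d) 0 0 = 0.
  apply/eqP; rewrite -oppr_eq0; apply/eqP.
  apply: (@linear_indep_root ((z *m A *m d) 0 0)).
  by rewrite rmorphN mulNr -[RHS]H mulrC !mxE.
have zd : z *m d = 0 by apply/matrixP => r s; rewrite !ord1 zd0 mxE.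
have zAd : z *m A *m d = 0.
  apply/matrixP => r s; rewrite !ord1 [RHS]mxE; apply/(fmorph_inj iota).
  rewrite rmorph0 -[RHS]H; move: zd0; rewrite !mxE => ->.
  by rewrite rmorph0 mulr0 subr0.
pose u := z *m invmx (krylov y A).
have zE : z = u 0 0 *: y + u 0 1 *: (y *m A) + u 0 2%:R *: (y *m A *m A).
  by rewrite -[LHS](mulmxKV U) -/u mul_krylovE.
have u2 : u 0 2%:R = 0.
  move: zd; rewrite zE !mulmxDl -!scalemxAl yd yAd yAAd !scaler0 !add0r.
  by move=> /matrixP/(_ 0 0); rewrite !mxE mulr1.
rewrite u2 scale0r addr0 in zE.
(* As [z = u0 y + u1 y A], the value of [z A d] is [u1]. *)
have u1 : u 0 1 = 0.
  move: zAd; rewrite zE !mulmxDl -!scalemxAl yAd yAAd !scaler0 !add0r.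
  by move=> /matrixP/(_ 0 0); rewrite !mxE mulr1.
by case: (zy (u 0 0)); rewrite {1}zE u1 scale0r addr0.
Qed.

(** * Evaluation at the root and a criterion for core sets *)

Definition root_eval (f : {poly 'M[F]_3}) : 'M[L]_3 :=
  (map_poly (map_mx iota) f).[t%:M].

Lemma root_evalM (f g : {poly 'M[F]_3}) :
  root_eval (f * g) = root_eval f * root_eval g.
Proof.
rewrite /root_eval rmorphM hornerM_comm // /comm_poly.
rewrite !horner_coef mulr_sumr mulr_suml; apply: eq_bigr => i _.
rewrite mulrA -[RHS]mulrA -exprSr exprS [RHS]mulrA; congr (_ * _).
exact/esym/scalar_mxC.
Qed.

(** Right evaluation puts the powers of [A] next to [x], where each [A^n] acts as [t^n]. *)
Lemma horner_eigenvector (f : {poly 'M[F]_3}) A x :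
  A^i *m x = t *: x -> (f.[A])^i *m x = root_eval f *m x.
Proof.
move=> Ax; rewrite /root_eval; elim/poly_ind: f => [|f c IH].
  by rewrite rmorph0 !horner0 map_mx0 !mul0mx.
rewrite rmorphD rmorphM /= map_polyX map_polyC !hornerMXaddC map_mxD !mulmxDl.
by rewrite map_mxM -!mulmxA Ax mul_scalar_mx -!scalemxAr IH.
Qed.

(** The null ideal is then exactly the kernel of the multiplicative map [root_eval]: conversely,
    [f(t) = 0] gives [f(A) x = 0], and the rows of [f(A)], being over [F], vanish. *)
Lemma core_root_eval (S : set 'M[F]_3) : S `<=` minpoly_class m ->
  (forall f, null_ideal S f -> root_eval f = 0) -> core S.
Proof.
move=> Sm Sf.
have null (f : {poly 'M[F]_3}) A : S A -> root_eval f = 0 -> f.[A] = 0.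
  move=> SA f0; have [x x0 Ax] := eigenvector_exists (Sm _ SA).
  apply/row_matrixP => i; rewrite linear0.
  apply: (mul_eigenvector_eq0 (Sm _ SA) x0 Ax).
  by rewrite map_row -row_mul horner_eigenvector // f0 mul0mx linear0.
split=> [A SA|f g Nf Ng A SA|h f Nf A SA|h f Nf A SA].
- by rewrite horner0.
- by rewrite hornerD hornerN Nf // Ng // subrr.
- by apply: null SA _; rewrite root_evalM (Sf f Nf) mulr0.
- by apply: null SA _; rewrite root_evalM (Sf f Nf) mul0r.
Qed.

(** Each row of [f(t)] kills all three eigenvectors, so it is a multiple of both [y A - t y] and
    [z A - t z], which forces it to be 0. *)
Lemma core_of_independent_nullvectors (S : set 'M[F]_3) A B C y z :
  S `<=` minpoly_class m -> S A -> S B -> S C -> A <> B -> A <> C ->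
  y != 0 -> z != 0 -> y *m A = y *m B -> z *m A = z *m C ->
  (forall a, z <> a *: y) -> core S.
Proof.
move=> Sm SA SB SC AB AC y0 z0 yAB zAC zy; apply: core_root_eval => // f Nf.
have [Am Bm Cm] := And3 (Sm _ SA) (Sm _ SB) (Sm _ SC).
have [xA xA0 AxA] := eigenvector_exists Am.
have [xB xB0 BxB] := eigenvector_exists Bm.
have [xC xC0 CxC] := eigenvector_exists Cm.
have kill D x : S D -> D^i *m x = t *: x ->
    forall i, row i (root_eval f) *m x = 0.
  move=> SD Dx i; rewrite -row_mul -(horner_eigenvector f Dx) Nf //.
  by rewrite map_mx0 mul0mx linear0.
apply/row_matrixP => i; rewrite linear0.
have sA := kill _ _ SA AxA i; have sB := kill _ _ SB BxB i.
have sC := kill _ _ SC CxC i.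
have [j sj] := kill_eigenvector_pair Am Bm AB y0 yAB xA0 xB0 AxA BxB sA sB.
have [k sk] := kill_eigenvector_pair Am Cm AC z0 zAC xA0 xC0 AxA CxC sA sC.
have k0 : k = 0 by apply: (pencil_scale_eq0 Am y0 zy (j := j)); rewrite -sj.
by rewrite sk k0 scale0r.
Qed.

End Eigenvectors.

(** * Counting the matrices that agree on one row over a finite field *)

Section Counting.
Variables (F : fieldType) (m : {poly F}) (q : nat).
Hypotheses (m_irr : irreducible_poly m) (m_size : size m = 4%N).
Hypothesis F_card : [set: F] #= `I_q.

Lemma card_agree_on_vector (S : set 'M[F]_3) (A : 'M[F]_3) (y : 'rV[F]_3) :
  S `<=` minpoly_class m -> mxminpoly A = m -> y != 0 ->
  (forall C, S C -> y *m C = y *m A) -> S #<= `I_(q ^ 3 - q ^ 2)%N.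
Proof.
move=> Sm Am y0 yS.
have /pcard_eqP/unsquash g := F_card.
have gq x : (g x < q)%N by have : `I_q (g x) by exact: funS.
(* The case [q = 0] is void because [F] contains 0; a successor bound gives usable ordinals. *)
case: q g gq => [g /(_ 0) //|n g gq].
pose h (x : F) : 'I_n.+1 := Ordinal (gq x).
have h_inj : injective h.
  by move=> x1 x2 /(congr1 val) /= /(@inj _ _ _ g); apply; rewrite in_setT.
have U := krylov_unit m_irr m_size Am y0.
pose u (C : 'M[F]_3) := y *m C *m C *m invmx (krylov y A).
have uE C : y *m C *m C = u C 0 0 *: y + u C 0 1 *: (y *m A)
    + u C 0 2%:R *: (y *m A *m A).
  by rewrite -mul_krylovE mulmxKV.
(* Otherwise [y C^2 = a y + b y C], using [y A = y C], and the row [(a, b, -1)] is a relation among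
   the Krylov rows of [C]. *)
have u2 C : S C -> u C 0 2%:R != 0.
  move=> SC; apply/eqP => u20.
  move: (uE C); rewrite u20 scale0r addr0 -(yS _ SC).
  move: (u C 0 0) (u C 0 1) => a b yCC.
  have UC := krylov_unit m_irr m_size (Sm _ SC) y0.
  pose v : 'rV[F]_3 := \row_(i < 3) [:: a; b; -1]`_i.
  have : v *m krylov y C = 0.
    by rewrite mul_krylovE !mxE /= yCC scaleN1r subrr.
  move/(canRL (mulmxK UC)); rewrite mul0mx => /rowP/(_ 2%:R).
  by rewrite !mxE /= => /eqP; rewrite oppr_eq0 oner_eq0.
have u_inj C D : S C -> S D -> u C = u D -> C = D.
  move=> SC SD uCD.
  (* A root of [m] is introduced only to apply [krylov_inj]: the Krylov rows [y], [y C = y A] and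
     [y C^2] agree for [C] and [D]. *)
  have [L _ [t tm _]] := irredp_FAdjoin m_irr.
  apply: (krylov_inj m_irr m_size tm (Sm _ SC) (Sm _ SD) y0).
  apply/row_matrixP => i; rewrite !rowK.
  case: i => [[|[|[|]]]] //= _; rewrite ?expr0 ?expr1 ?(yS C) ?(yS D) //.
  by rewrite !expr2 ![y *m (_ * _)]mulmxA uE uCD -uE.
(* Codes of coordinate triples with nonzero last entry; [h 0] is the code of 0. *)
pose X := [set w : 'I_n.+1 * 'I_n.+1 * 'I_n.+1 | w.2 != h 0]%SET.
have cardX : #|X| = (n.+1 ^ 3 - n.+1 ^ 2)%N.
  have -> : X = finset.setX [set: 'I_n.+1 * 'I_n.+1]%SET [set~ h 0]%SET.
    by apply/finset.setP => -[w1 w2]; rewrite !inE.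
  rewrite cardsX cardsT card_prod cardsC1 !card_ord.
  by rewrite (expnSr _ 2) mulnn mulnS addKn.
pose c (C : 'M[F]_3) := (h (u C 0 0), h (u C 0 1), h (u C 0 2%:R)).
have cX C : S C -> c C \in X.
  by move=> SC; rewrite inE /=; apply: contra (u2 _ SC) => /eqP/h_inj ->.
have c_inj C D : S C -> S D -> c C = c D -> C = D.
  move=> SC SD /eqP; rewrite !xpair_eqE => /andP[/andP[/eqP/h_inj e1]].
  move=> /eqP/h_inj e2 /eqP/h_inj e3; apply: u_inj => //.
  by apply: (can_inj (mulmxK U)); rewrite !mul_krylovE e1 e2 e3.
(* The position in an enumeration of [X] turns a triple into a number below [q^3 - q^2]. *)
pose k C := index (c C) (enum X).
have k_inj : {in S &, injective k}.
  move=> C D; rewrite !inE => SC SD kCD; apply: c_inj => //.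
  rewrite -(nth_index (c C) (etrans (mem_enum _ _) (cX _ SC))).
  rewrite -[RHS](nth_index (c C) (etrans (mem_enum _ _) (cX _ SD))).
  by rewrite -/(k C) kCD.
rewrite -(card_le_eql (inj_card_eq k_inj)); apply: subset_card_le.
move=> _ [C SC <-] /=; rewrite -cardX cardE index_mem mem_enum; exact: cX.
Qed.

End Counting.

(** * Derivation of both criteria *)

Theorem corollary3p13 (F : fieldType) (a b c : F) (m : {poly F})
    (m_def : m = 'X^3 + a *: 'X^2 + b *: 'X + c%:P)
    (m_irr : irreducible_poly m)
    (S : set 'M[F]_3) (S_sub : S `<=` minpoly_class m) :
  ((exists A B C : 'M[F]_3,
      [/\ S A, S B & S C] /\ [/\ A <> B, A <> C & B <> C] /\
      [/\ singular (B - A), singular (C - A)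
        & left_nullspace (B - A) <> left_nullspace (C - A)]) ->
    core S)
  /\
  (forall q : nat,
      [set: F] #= `I_q ->
      `I_(q ^ 3 - q ^ 2 + 1)%N #<= S ->
      (exists2 A : 'M[F]_3, S A & forall B, S B -> singular (B - A)) ->
    core S).
Proof.
have m_size : size m = 4%N.
  rewrite m_def -!addrA size_polyDl size_polyXn //.
  have : (size (a *: 'X^2 + (b *: 'X + c%:P))%R <= 3)%N; last by [].
  rewrite (leq_trans (size_polyD _ _)) // geq_max.
  rewrite (leq_trans (size_scale_leq _ _)) ?size_polyXn //=.
  rewrite (leq_trans (size_polyD _ _)) // geq_max.
  rewrite (leq_trans (size_scale_leq _ _)) ?size_polyX //=.
  by rewrite size_polyC; case: (c == 0).
have [L _ [t m_root _]] := irredp_FAdjoin m_irr.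
have core3 := core_of_independent_nullvectors m_irr m_size m_root S_sub.
have nullvector (X : 'M[F]_3) : singular X ->
    exists2 y : 'rV_3, y != 0 & y *m X = 0.
  by rewrite /singular unitmxE unitfE negbK => /det0P.
(* A row [z] outside the nullspace of [B - A] is not a multiple of a row [y] inside it. *)
have core_null A B C : S A -> S B -> S C -> A <> B -> A <> C ->
    singular (B - A) ->
    forall z, left_nullspace (C - A) z -> ~ left_nullspace (B - A) z -> core S.
  move=> SA SB SC AB AC /nullvector [y y0 yBA] z zCA zBA.
  have z0 : z != 0 by apply: contra_notN zBA => /eqP ->; exact: mul0mx.
  apply: (core3 A B C y z) => //.
  - by apply/esym/subr0_eq; rewrite -mulmxBr.
  - by apply/esym/subr0_eq; rewrite -mulmxBr.
  - move=> k zE; apply: zBA.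
    by rewrite zE /left_nullspace /= -scalemxAl yBA scaler0.
have part1 A B C : S A -> S B -> S C -> A <> B -> A <> C ->
    singular (B - A) -> singular (C - A) ->
    left_nullspace (B - A) <> left_nullspace (C - A) -> core S.
  (* Unequal nullspaces fail one of the two inclusions; either failure supplies a row [z], with [B]
     and [C] exchanged as needed. *)
  move=> SA SB SC AB AC sB sC nBC; apply: contrapT => ncore; apply: nBC.
  apply/seteqP; split=> z zn; apply: contrapT => zn'; apply: ncore.
    exact: (core_null A C B _ _ _ _ _ _ z).
  exact: (core_null A B C _ _ _ _ _ _ z).
split=> [[A [B [C [[SA SB SC] [[AB AC _] [sB sC nBC]]]]]]|
  q F_card S_card [A SA sA]].
  exact: (part1 A B C).
apply: contrapT => ncore.
(* By part (1), if [S] is not core, every [C - A] with [C] different from [A] has the same nullspace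
   as one fixed [B - A]. If [A] is the only element, any nonzero row serves, here the all-ones
   row. *)
have [y y0 yS] : exists2 y : 'rV[F]_3,
    y != 0 & forall C, S C -> y *m C = y *m A.
  case: (pselect (exists2 B, S B & A <> B)) => [[B SB AB]|noB]; last first.
    exists (const_mx 1).
      by apply/eqP => /rowP/(_ 0); rewrite !mxE => /eqP; rewrite oner_eq0.
    by move=> C SC; have [->//|AC] := pselect (A = C); case: noB; exists C.
  have [y y0 yBA] := nullvector _ (sA _ SB); exists y => // C SC.
  have [->//|AC] := pselect (A = C).
  apply/subr0_eq; rewrite -mulmxBr; apply: contrapT => yCA; apply: ncore.
  apply: (part1 A B C) => //; [exact: sA | exact: sA |].
  by move=> nBC; apply: yCA; have : left_nullspace (B - A) y by []; rewrite nBC.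
have := card_agree_on_vector m_irr m_size F_card S_sub (S_sub _ SA) y0 yS.
by move=> /(card_le_trans S_card); rewrite card_le_II addn1 ltnn.
Qed.
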